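(* For every real $b>1$, $$\sum_{j=1}^{\infty}\Re\left(\Gamma\left(\frac{2i\pi j}{\ln b}\right)\right)=\frac{\ln b}{2}\sum_{j=0}^{\infty}\left(e^{-1/b^{j}}-1+e^{-b^{j}}\right)+\left(\frac14-\frac{1}{2e}\right)\ln b+\frac{\gamma}{2}.$$
   Context: $\gamma$ is the Euler–Mascheroni constant, $\Gamma$ is the Gamma function, $e$ is the base of natural logarithms, and $\Re$ denotes the real part. *)

(* Defs.v *)
From Stdlib Require Import Reals ZArith.
From Coquelicot Require Import Coquelicot.
Open Scope R_scope.

(** [Cexp (x + i y) = e^x (cos y + i sin y)]. *)
Definition Cexp (z : C) : C :=
  (exp (Re z) * cos (Im z), exp (Re z) * sin (Im z)).

(** Complex power of a base [t > 0], with the real logarithm of [t]. *)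
Definition Rpow_C (t : R) (z : C) : C := Cexp (z * RtoC (ln t))%C.

(** Euler's integral of the second kind, over the open half-line [t > 0];
    it is the Gamma function only for [0 < Re z]. *)
Definition Euler_integral (z : C) : C :=
  RInt_gen (V := C_R_CompleteNormedModule)
    (fun t : R => (Rpow_C t (z - 1) * RtoC (exp (- t)))%C)
    (at_right 0) (Rbar_locally p_infty).

(** Rising factorial [z (z + 1) ... (z + n - 1)]. *)
Fixpoint Crising (z : C) (n : nat) : C :=
  match n with
  | O => RtoC 1
  | S m => (Crising z m * (z + RtoC (INR m)))%C
  end.

(** The Gamma function, continued from the half-plane [0 < Re z] by
    [Gamma z = Gamma (z + n) / (z (z + 1) ... (z + n - 1))].  Here [n] is the
    least natural number with [0 < Re z + n], so that [n = 0] when [0 < Re z]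
    and [n = 1] on the imaginary axis.  The value is meaningless at the poles
    [0, -1, -2, ...]. *)
Definition CGamma (z : C) : C :=
  let n := Z.to_nat (up (- Re z)) in
  (Euler_integral (z + RtoC (INR n)) / Crising z n)%C.

(** Euler-Mascheroni constant, the limit of [1 + 1/2 + ... + 1/m - ln m];
    the sequence is indexed by [n = m - 1]. *)
Definition Euler_Mascheroni : R :=
  real (Lim_seq (fun n : nat =>
    sum_f_R0 (fun k : nat => / INR (S k)) n - ln (INR (S n)))).

(* Main.v *)
Require Import Defs.
From Stdlib Require Import Reals Lra Lia Psatz.
From Coquelicot Require Import Coquelicot.
Open Scope R_scope.

(** Write [L = ln b] and [y_j = 2 pi j / L].  The function [exp (- exp u)]
    decreases from 1 to 0 on the real line; its trapezoidal sum with step [L]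
    is, up to boundary terms, the series on the right-hand side.  The theorem
    is the Euler-Maclaurin formula for this sum, with the periodic Bernoulli
    kernel expanded in its Fourier series: each frequency contributes the real
    part of a value of the Gamma function on the imaginary axis.

    In detail, [Gamma (i y) = Gamma (1 + i y) / (i y)] has real part the
    integral of [sin (y ln t) / y * exp (- t)] over [t > 0]
    ([Re_CGamma_imaginary]).  The sum of [sin (y_j u) / y_j] over [j] is
    [L / 4 - s / 2], where [s] is the residue of [u] modulo [L], unless
    [s = 0].  On an interval [a, a b] with [ln a] a multiple of [L], one
    integration by parts turns the integral of [(L / 4 - (ln t - ln a) / 2) exp (- t)] into
    [L / 4 (exp (- a) + exp (- a b))] minus half the integral of
    [exp (- t) / t].  Adding up over [b^-M, b^M] gives a finite identity
    whose limit as [M] grows is the closed form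
    ([is_lim_seq_half_trapezoid_sum]); Euler's constant enters because the
    integral of [exp (- t) / t] over [eps, oo) is [- ln eps - gamma + o(1)]
    ([exp_integral_Euler_Mascheroni]).

    The sum over [j] and the integral have to be exchanged, although the sine
    series does not converge uniformly near multiples of [L].  Another
    integration by parts moves the error to its antiderivative, the cosine
    series of a quadratic polynomial, whose remainder after the first [N] terms
    is at most [2 / N] uniformly ([parabola_defect_bound]).  This bounds the error
    independently of [M] ([Euler_Maclaurin]), so that [M] may tend to infinity
    before the number of terms does. *)

(** * Elementary estimates and integration *)

Lemma INR_S_pos (n : nat) : 0 < INR (S n).
Proof. apply lt_0_INR, Nat.lt_0_succ. Qed.

Lemma exists_nat_ge (x : R) : exists n : nat, x <= INR n.
Proof.
  destruct (Rle_dec 0 x) as [H|H].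
  - destruct (nfloor_ex x H) as [n Hn]. exists (S n). rewrite S_INR. lra.
  - exists 0%nat. simpl. lra.
Qed.

Lemma abs_increment_le (f df : R -> R) (a b M : R) :
  a <= b ->
  (forall t, a <= t <= b -> is_derive f t (df t)) ->
  (forall t, a <= t <= b -> Rabs (df t) <= M) ->
  Rabs (f b - f a) <= M * (b - a).
Proof.
  intros Hab Hd HM.
  destruct (MVT_gen f a b df) as [c [Hc E]];
    rewrite ?Rmin_left, ?Rmax_right in * by exact Hab.
  - intros t Ht. apply Hd. lra.
  - intros t Ht. apply continuity_pt_filterlim.
    apply (ex_derive_continuous (V := R_NormedModule)). exists (df t). now apply Hd.
  - rewrite E, Rabs_mult, (Rabs_pos_eq (b - a)) by lra.
    apply Rmult_le_compat_r; [lra|]. now apply HM.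
Qed.

Lemma is_RInt_antiderivative (G g : R -> R) (a b : R) :
  a <= b ->
  (forall t, a <= t <= b -> is_derive G t (g t)) ->
  (forall t, a <= t <= b -> continuous g t) ->
  is_RInt g a b (G b - G a).
Proof.
  intros Hab HG Hg.
  apply (is_RInt_derive (V := R_CompleteNormedModule) G g a b);
    rewrite Rmin_left, Rmax_right by exact Hab; assumption.
Qed.

(** All error terms below are bounded in this form, with an explicit
    antiderivative of the majorant. *)
Lemma RInt_abs_le_antiderivative (f G g : R -> R) (a b : R) :
  a <= b ->
  (forall t, a <= t <= b -> is_derive G t (g t)) ->
  (forall t, a <= t <= b -> continuous g t) ->
  ex_RInt f a b ->
  (forall t, a <= t <= b -> Rabs (f t) <= g t) ->
  Rabs (RInt f a b) <= G b - G a.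
Proof.
  intros Hab HG Hg Hf Hfg.
  apply (norm_RInt_le (V := R_NormedModule) f g a b).
  - exact Hab.
  - exact Hfg.
  - apply (RInt_correct (V := R_CompleteNormedModule)). exact Hf.
  - now apply is_RInt_antiderivative.
Qed.

Lemma ex_RInt_continuous_on (f : R -> R) (a b : R) :
  a <= b -> (forall t, a <= t <= b -> continuous f t) -> ex_RInt f a b.
Proof.
  intros Hab Hf. apply (ex_RInt_continuous (V := R_CompleteNormedModule)).
  rewrite Rmin_left, Rmax_right by exact Hab. exact Hf.
Qed.

Lemma exp_le_1 (x : R) : x <= 0 -> exp x <= 1.
Proof.
  intros Hx. rewrite <- exp_0. destruct (Req_dec x 0) as [->|H]; [lra|].
  left. apply exp_increasing. lra.
Qed.

Lemma ln_le_sub_1 (x : R) : 0 < x -> ln x <= x - 1.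
Proof.
  intros Hx. pose proof (exp_ineq1_le (ln x)) as H. rewrite exp_ln in H; lra.
Qed.

(** * Euler's constant and the exponential integral *)

Lemma continuous_exp_div (t : R) : 0 < t -> continuous (fun t => exp (- t) / t) t.
Proof.
  intros Ht. apply (ex_derive_continuous (V := R_NormedModule)).
  auto_derive. lra.
Qed.

Lemma ex_RInt_exp_div (a b : R) : 0 < a <= b -> ex_RInt (fun t => exp (- t) / t) a b.
Proof.
  intros H. apply ex_RInt_continuous_on; [lra|].
  intros t Ht. apply continuous_exp_div. lra.
Qed.

(** The sequence decreases and stays nonnegative, both by [ln x <= x - 1]. *)
Lemma Euler_Mascheroni_is_lim :
  is_lim_seq (fun n => sum_f_R0 (fun k => / INR (S k)) n - ln (INR (S n)))
    Euler_Mascheroni.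
Proof.
  apply (Lim_seq_correct' _).
  apply ex_finite_lim_seq_decr with (M := 0).
  - intros n. rewrite tech5.
    assert (H1 : 0 < INR (S n)) by apply INR_S_pos.
    assert (H2 : 0 < INR (S (S n))) by apply INR_S_pos.
    pose proof (ln_le_sub_1 (INR (S n) / INR (S (S n)))) as H.
    rewrite ln_div in H by assumption.
    assert (E : INR (S n) / INR (S (S n)) - 1 = - / INR (S (S n))).
    { rewrite (S_INR (S n)) in *. field. lra. }
    assert (0 < INR (S n) / INR (S (S n))) by (now apply Rdiv_lt_0_compat).
    specialize (H H0). lra.
  - (* the harmonic sum even exceeds the logarithm of the next integer *)
    assert (K : forall n, ln (INR (S (S n))) <= sum_f_R0 (fun k => / INR (S k)) n).
    { induction n as [|n IH].
      - simpl. rewrite Rinv_1. pose proof (ln_le_sub_1 (1 + 1)). lra.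
      - rewrite tech5.
        assert (H1 : 0 < INR (S (S n))) by apply INR_S_pos.
        assert (H2 : 0 < INR (S (S (S n)))) by apply INR_S_pos.
        pose proof (ln_le_sub_1 (INR (S (S (S n))) / INR (S (S n)))) as H.
        rewrite ln_div in H by assumption.
        assert (E : INR (S (S (S n))) / INR (S (S n)) - 1 = / INR (S (S n))).
        { rewrite (S_INR (S (S n))). field. lra. }
        assert (0 < INR (S (S (S n))) / INR (S (S n))) by (now apply Rdiv_lt_0_compat).
        specialize (H H0). lra. }
    intros n. specialize (K n).
    assert (ln (INR (S n)) <= ln (INR (S (S n)))).
    { left. apply ln_increasing; [apply INR_S_pos|]. apply lt_INR. lia. }
    lra.
Qed.

(** The upper bound is Bernoulli's inequality applied to
    [(1 - t/m)^m exp t >= (1 - t/m)^m (1 + t/m)^m = (1 - t^2/m^2)^m]. *)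
Lemma exp_sub_pow_bound (n : nat) (t : R) :
  0 <= t <= INR (S n) ->
  0 <= exp (- t) - (1 - t / INR (S n)) ^ S n <= t ^ 2 / INR (S n) * exp (- t).
Proof.
  set (m := INR (S n)). intros Ht.
  assert (Hm : 0 < m) by apply INR_S_pos.
  assert (Hx : 0 <= t / m <= 1).
  { split. apply Rdiv_le_0_compat; lra. apply Rle_div_l; lra. }
  assert (Hpow : forall x, exp (m * x) = exp x ^ S n).
  { intros x. unfold m. generalize (S n) as k. induction k as [|k IH].
    - rewrite Rmult_0_l. exact exp_0.
    - rewrite S_INR, Rmult_plus_distr_r, exp_plus, IH, Rmult_1_l. simpl. ring. }
  split.
  - enough ((1 - t / m) ^ S n <= exp (- t)) by lra.
    replace (- t) with (m * (- (t / m))) by (field; lra).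
    rewrite Hpow. apply pow_incr. split; [lra|].
    pose proof (exp_ineq1_le (- (t / m))). lra.
  - assert (H1 : 1 - t ^ 2 / m <= (1 - t / m) ^ S n * exp t).
    { apply Rle_trans with ((1 - t / m) ^ S n * (1 + t / m) ^ S n).
      - rewrite <- Rpow_mult_distr.
        replace ((1 - t / m) * (1 + t / m)) with (1 + (- (t / m) ^ 2)) by ring.
        replace (1 - t ^ 2 / m) with (1 + INR (S n) * (- (t / m) ^ 2))
          by (fold m; field; lra).
        assert (Hy : 0 <= (t / m) ^ 2 <= 1) by nra.
        revert Hy. generalize ((t / m) ^ 2). clear. intros y Hy.
        generalize (S n) as k. induction k as [|k IH]; [simpl; lra|].
        rewrite S_INR. simpl. pose proof (pos_INR k). nra.
      - apply Rmult_le_compat_l; [apply pow_le; lra|].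
        replace (exp t) with (exp (t / m) ^ S n)
          by (rewrite <- Hpow; f_equal; field; lra).
        apply pow_incr. split; [lra|]. apply exp_ineq1_le. }
    assert (He : exp t * exp (- t) = 1) by (rewrite <- exp_plus, Rplus_opp_r; apply exp_0).
    pose proof (exp_pos (- t)) as Hp.
    apply Rmult_le_compat_r with (r := exp (- t)) in H1; [|lra].
    rewrite Rmult_assoc, He in H1. lra.
Qed.

(** Summing the geometric series in [1 - t/m] gives
    [1/t - (1/m) (1 + ... + (1 - t/m)^n) = (1 - t/m)^(n+1) / t]. *)
Lemma is_derive_ln_plus_powers (m : R) (n : nat) (t : R) :
  0 < m -> 0 < t ->
  is_derive (fun t => ln t + sum_n (fun k => (1 - t / m) ^ S k / INR (S k)) n) t
    ((1 - t / m) ^ S n / t).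
Proof.
  intros Hm Ht. induction n as [|n IH].
  - apply is_derive_ext with (fun t => ln t + (1 - t / m)).
    + intros u. rewrite sum_O. simpl. field. lra.
    + auto_derive; [lra|]. simpl. field. lra.
  - apply is_derive_ext with (fun t =>
      (ln t + sum_n (fun k => (1 - t / m) ^ S k / INR (S k)) n)
      + (1 - t / m) ^ S (S n) / INR (S (S n))).
    + intros u. rewrite sum_Sn. unfold plus; simpl. ring.
    + replace ((1 - t / m) ^ S (S n) / t)
        with ((1 - t / m) ^ S n / t + (- / m * (1 - t / m) ^ S n)).
      2:{ change ((1 - t / m) ^ S (S n)) with ((1 - t / m) * (1 - t / m) ^ S n).
          field. lra. }
      apply (is_derive_plus (V := R_NormedModule)); [exact IH|].
      assert (H2 : INR (S (S n)) <> 0) by (apply not_0_INR; lia).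
      auto_derive; [exact I|].
      change (match n with O => 1 | S _ => INR n + 1 end) with (INR (S n)).
      rewrite (S_INR (S n)) in H2.
      change (1 + - (t * / m)) with (1 - t / m).
      simpl pow. generalize ((1 - t / m) ^ n) as q. intros q. field. lra.
Qed.

(** With [m = n + 1], the antiderivative equals [ln m] at [m] and, up to an error
    of at most [m (eps/m) = eps], [ln eps] plus the harmonic sum at [eps]. *)
Lemma RInt_pow_div (n : nat) (eps : R) :
  0 < eps <= INR (S n) ->
  exists v, is_RInt (fun t => (1 - t / INR (S n)) ^ S n / t) eps (INR (S n)) v /\
  Rabs (v + ln eps + (sum_f_R0 (fun k => / INR (S k)) n - ln (INR (S n)))) <= eps.
Proof.
  set (m := INR (S n)). intros He.
  eexists; split.
  - apply (is_RInt_antiderivative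
      (fun t => ln t + sum_n (fun k => (1 - t / m) ^ S k / INR (S k)) n)).
    + lra.
    + intros t Ht. apply is_derive_ln_plus_powers; lra.
    + intros t Ht. apply (ex_derive_continuous (V := R_NormedModule)).
      auto_derive. lra.
  - cbv beta. rewrite <- sum_n_Reals.
    replace (sum_n (fun k => (1 - m / m) ^ S k / INR (S k)) n) with 0.
    2:{ symmetry. rewrite (sum_n_ext _ (fun _ => 0)).
        - rewrite sum_n_const. apply Rmult_0_r.
        - intros k. replace (1 - m / m) with 0 by (field; lra). rewrite pow_i by lia.
          apply Rmult_0_l. }
    replace (_ + ln eps + _) with (sum_n (fun k => / INR (S k)) n
       - sum_n (fun k => (1 - eps / m) ^ S k / INR (S k)) n) by (simpl; ring).
    assert (Hx : 0 <= eps / m <= 1).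
    { split. apply Rdiv_le_0_compat; lra. apply Rle_div_l; lra. }
    assert (K : forall j, 0 <= sum_n (fun k => / INR (S k)) j
       - sum_n (fun k => (1 - eps / m) ^ S k / INR (S k)) j <= INR (S j) * (eps / m)).
    { assert (T : forall k, 0 <= / INR (S k) - (1 - eps / m) ^ S k / INR (S k) <= eps / m).
      { intros k. assert (Hk : 0 < INR (S k)) by apply INR_S_pos.
        replace (_ - _) with ((1 - (1 - eps / m) ^ S k) / INR (S k)) by (field; lra).
        assert (B : 1 - INR (S k) * (eps / m) <= (1 - eps / m) ^ S k <= 1).
        { clear - Hx. generalize (S k) as i. intros i.
          induction i as [|i IH]; [simpl; lra|].
          rewrite S_INR. simpl. pose proof (pos_INR i). nra. }
        split.
        - apply Rdiv_le_0_compat; lra.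
        - apply Rle_div_l; lra. }
      induction j as [|j IH].
      - rewrite !sum_O. specialize (T 0%nat). simpl INR in *. lra.
      - rewrite !sum_Sn. unfold plus; simpl AbelianMonoid.sort.
        specialize (T (S j)). rewrite (S_INR (S j)). simpl in *. lra. }
    specialize (K n). fold m in K.
    replace (m * (eps / m)) with eps in K by (field; lra).
    rewrite Rabs_pos_eq; lra.
Qed.

(** Replace [exp (- t)] by [(1 - t/m)^m] on [eps, m]: this costs at most [1/m],
    since the integral of [t exp (- t)] is at most 1, and the tail beyond [B] costs
    at most [exp (- B)].  The new integral is known from [RInt_pow_div]; let [m]
    tend to infinity. *)
Lemma exp_integral_Euler_Mascheroni (eps B : R) :
  0 < eps <= B -> 1 <= B ->
  Rabs (RInt (fun t => exp (- t) / t) eps B + ln eps + Euler_Mascheroni)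
    <= eps + exp (- B).
Proof.
  intros He HB.
  set (c := RInt (fun t => exp (- t) / t) eps B + ln eps).
  pose (a := fun n => sum_f_R0 (fun k => / INR (S k)) n - ln (INR (S n))).
  assert (K : forall n, B <= INR (S n) ->
    Rabs (c + a n) <= eps + exp (- B) + / INR (S n)).
  { intros n Hn. set (m := INR (S n)) in *.
    destruct (RInt_pow_div n eps) as [v [Hv Hva]]; [fold m; lra|].
    fold m in Hv, Hva. fold (a n) in Hva.
    assert (E1 : RInt (fun t => exp (- t) / t) eps B + RInt (fun t => exp (- t) / t) B m
       = RInt (fun t => exp (- t) / t) eps m).
    { apply (RInt_Chasles (V := R_CompleteNormedModule)); apply ex_RInt_exp_div; lra. }
    assert (E2 : Rabs (RInt (fun t => exp (- t) / t) B m) <= - exp (- m) - - exp (- B)).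
    { apply (RInt_abs_le_antiderivative _ (fun t => - exp (- t)) (fun t => exp (- t))).
      - lra.
      - intros t _. auto_derive; [exact I|ring].
      - intros t _. apply (ex_derive_continuous (V := R_NormedModule)).
        auto_derive. exact I.
      - apply ex_RInt_exp_div; lra.
      - intros t Ht. pose proof (exp_pos (- t)).
        rewrite Rabs_pos_eq by (apply Rdiv_le_0_compat; lra).
        apply Rle_div_l; [lra|]. nra. }
    assert (E3 : Rabs (RInt (fun t => exp (- t) / t - (1 - t / m) ^ S n / t) eps m)
       <= - (1 + m) * exp (- m) / m - - (1 + eps) * exp (- eps) / m).
    { apply (RInt_abs_le_antiderivative _ (fun t => - (1 + t) * exp (- t) / m)
        (fun t => t * exp (- t) / m)).
      - lra.
      - intros t _. auto_derive; [lra|]. field. lra.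
      - intros t _. apply (ex_derive_continuous (V := R_NormedModule)).
        auto_derive. lra.
      - apply (ex_RInt_minus (V := R_NormedModule)).
        + apply ex_RInt_exp_div; lra.
        + now exists v.
      - intros t Ht. destruct (exp_sub_pow_bound n t) as [L U]; [fold m; lra|].
        fold m in L, U.
        replace (exp (- t) / t - (1 - t / m) ^ S n / t)
          with ((exp (- t) - (1 - t / m) ^ S n) / t) by (field; lra).
        rewrite Rabs_pos_eq by (apply Rdiv_le_0_compat; lra).
        apply Rle_div_l; [lra|].
        replace (t * exp (- t) / m * t) with (t ^ 2 / m * exp (- t)) by (field; lra).
        exact U. }
    assert (E4 : RInt (fun t => exp (- t) / t - (1 - t / m) ^ S n / t) eps m
       = RInt (fun t => exp (- t) / t) eps m - v).
    { rewrite <- (is_RInt_unique _ _ _ _ Hv).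
      apply (RInt_minus (V := R_CompleteNormedModule)).
      - apply ex_RInt_exp_div; lra.
      - now exists v. }
    assert (E5 : (1 + eps) * exp (- eps) <= 1).
    { pose proof (exp_ineq1_le eps). pose proof (exp_pos (- eps)).
      assert (exp eps * exp (- eps) = 1) by (rewrite <- exp_plus, Rplus_opp_r; apply exp_0).
      nra. }
    assert (E6 : - (1 + m) * exp (- m) / m - - (1 + eps) * exp (- eps) / m <= / m).
    { replace (_ - _) with (((1 + eps) * exp (- eps) - (1 + m) * exp (- m)) * / m)
        by (field; lra).
      rewrite <- (Rmult_1_l (/ m)) at 2.
      apply Rmult_le_compat_r; [left; apply Rinv_0_lt_compat; lra|].
      pose proof (exp_pos (- m)). nra. }
    pose proof (exp_pos (- m)).
    rewrite E4 in E3.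
    replace (c + a n) with ((RInt (fun t => exp (- t) / t) eps m - v)
      + (v + ln eps + a n) - RInt (fun t => exp (- t) / t) B m) by (unfold c; lra).
    apply Rabs_le. apply Rabs_le_between in E2, E3, Hva.
    change (sum_f_R0 _ n - ln m) with (a n) in Hva. split; lra. }
  assert (HL : is_lim_seq (fun n => Rabs (c + a n)) (Rabs (c + Euler_Mascheroni))).
  { apply (is_lim_seq_abs _ (c + Euler_Mascheroni)).
    apply (is_lim_seq_plus' (fun _ => c)).
    - apply is_lim_seq_const.
    - exact Euler_Mascheroni_is_lim. }
  assert (HR : is_lim_seq (fun n => eps + exp (- B) + / INR (S n)) (eps + exp (- B) + 0)).
  { apply (is_lim_seq_plus' (fun _ => eps + exp (- B))).
    - apply is_lim_seq_const.
    - apply (is_lim_seq_incr_1 (fun n => / INR n)).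
      apply (is_lim_seq_inv _ p_infty); [apply is_lim_seq_INR|discriminate]. }
  rewrite Rplus_0_r in HR.
  destruct (nfloor_ex B) as [N HN]; [lra|].
  refine (is_lim_seq_le_loc _ _ _ _ _ HL HR).
  exists N. intros n Hn. apply K. rewrite S_INR. apply le_INR in Hn. lra.
Qed.

(** * Fourier series of the second Bernoulli polynomial *)

(** The error of the expansion [(PI - x) / 2 = sum sin (j x) / j] on [(0, 2 PI)]
    after [N + 1] terms, [j = 1, ..., N + 1]. *)
Definition sawtooth_defect (N : nat) (x : R) : R :=
  sum_n (fun j => sin (INR (S j) * x) / INR (S j)) N - (PI - x) / 2.

(** The antiderivative of [sawtooth_defect N] that vanishes at 0. *)
Definition parabola_defect (N : nat) (x : R) : R :=
  sum_n (fun j => (1 - cos (INR (S j) * x)) / INR (S j) ^ 2) N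
  - (PI * x / 2 - x ^ 2 / 4).

Lemma Dirichlet_kernel (N : nat) (x : R) :
  2 * sin (x / 2) * (sum_n (fun j => cos (INR (S j) * x)) N + 1 / 2)
  = sin ((INR N + 3 / 2) * x).
Proof.
  assert (T : forall k, 2 * sin (x / 2) * cos (k * x)
     = sin ((k + 1 / 2) * x) - sin ((k - 1 / 2) * x)).
  { intros k. replace ((k + 1 / 2) * x) with (k * x + x / 2) by field.
    replace ((k - 1 / 2) * x) with (k * x - x / 2) by field.
    rewrite sin_plus, sin_minus. ring. }
  induction N as [|N IH].
  - rewrite sum_O, Rmult_plus_distr_l, T. simpl INR.
    replace ((1 - 1 / 2) * x) with (x / 2) by field.
    replace ((1 + 1 / 2) * x) with ((0 + 3 / 2) * x) by field. field.
  - rewrite sum_Sn. unfold plus; cbn -[INR sum_n].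
    rewrite Rplus_assoc, (Rplus_comm (cos _)), <- Rplus_assoc, Rmult_plus_distr_l.
    rewrite IH, T, !S_INR.
    replace ((INR N + 1 + 1 - 1 / 2) * x) with ((INR N + 3 / 2) * x) by field.
    replace ((INR N + 1 + 1 + 1 / 2) * x) with ((INR N + 1 + 3 / 2) * x) by field.
    ring.
Qed.

Lemma is_derive_parabola_defect (N : nat) (x : R) :
  is_derive (parabola_defect N) x (sawtooth_defect N x).
Proof.
  apply (is_derive_minus (V := R_NormedModule)).
  - apply (is_derive_sum_n (V := R_NormedModule)
      (fun j x => (1 - cos (INR (S j) * x)) / INR (S j) ^ 2)).
    intros k _. pose proof (INR_S_pos k). set (c := INR (S k)) in *. clearbody c.
    auto_derive; [exact I|]. field. lra.
  - auto_derive; [exact I|]. field.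
Qed.

Lemma is_derive_sawtooth_defect (N : nat) (x : R) :
  is_derive (sawtooth_defect N) x (sum_n (fun j => cos (INR (S j) * x)) N + 1 / 2).
Proof.
  replace (_ + 1 / 2)
    with (minus (sum_n (fun j => cos (INR (S j) * x)) N) (- (1 / 2)))
    by (unfold minus, plus, opp; cbn -[INR sum_n]; ring).
  apply (is_derive_minus (V := R_NormedModule)).
  - apply (is_derive_sum_n (V := R_NormedModule)
      (fun j x => sin (INR (S j) * x) / INR (S j))).
    intros k _. pose proof (INR_S_pos k). set (c := INR (S k)) in *. clearbody c.
    auto_derive; [exact I|]. field. lra.
  - auto_derive; [exact I|]. field.
Qed.

(** The derivative of the defect is the Dirichlet kernel
    [sin (q x) / (2 sin (x / 2))] with [q = N + 3/2].  Adding
    [cos (q x) / (2 q sin (x / 2))] cancels it up to a term of order [1/q], and the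
    sum vanishes at [PI], so the mean value theorem applies. *)
Lemma sawtooth_defect_bound (d : R) :
  0 < d <= PI ->
  exists C, forall N x, d <= x <= PI ->
    Rabs (sawtooth_defect N x) <= C / (INR N + 3 / 2).
Proof.
  intros Hd. pose proof PI_RGT_0 as Hpi.
  set (s := sin (d / 2)).
  assert (Hs : 0 < s) by (apply sin_gt_0; lra).
  exists (PI / (4 * s ^ 2) + 1 / (2 * s)). intros N x Hx.
  pose proof (pos_INR N) as HN. set (q := INR N + 3 / 2).
  assert (Hq : 0 < q) by (unfold q; lra).
  assert (Hsin : forall t, d <= t <= PI -> s <= sin (t / 2)).
  { intros t Ht. apply sin_incr_1; lra. }
  set (f := fun t => sawtooth_defect N t + cos (q * t) / (2 * q * sin (t / 2))).
  assert (Hf : Rabs (f PI - f x) <= 1 / (4 * q * s ^ 2) * (PI - x)).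
  { apply abs_increment_le
      with (df := fun t => - (cos (q * t) * cos (t / 2)) / (4 * q * sin (t / 2) ^ 2)).
    - lra.
    - intros t Ht. specialize (Hsin t ltac:(lra)).
      replace (- (cos (q * t) * cos (t / 2)) / (4 * q * sin (t / 2) ^ 2))
        with (plus (sum_n (fun j => cos (INR (S j) * t)) N + 1 / 2)
          (- sin (q * t) / (2 * sin (t / 2))
           - (cos (q * t) * cos (t / 2)) / (4 * q * sin (t / 2) ^ 2))).
      2:{ pose proof (Dirichlet_kernel N t) as D. fold q in D.
          rewrite <- D. set (Z := sum_n _ N + 1 / 2). unfold plus; cbn -[Z]. clearbody Z.
          field. lra. }
      apply (is_derive_plus (V := R_NormedModule)).
      + apply is_derive_sawtooth_defect.
      + auto_derive.
        * change (2 * q * sin (t * / 2) <> 0). change (t * / 2) with (t / 2).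
          apply Rmult_integral_contrapositive. lra.
        * change (t * / 2) with (t / 2). field. lra.
    - intros t Ht. specialize (Hsin t ltac:(lra)).
      unfold Rdiv at 1. rewrite Rabs_mult, Rabs_Ropp, Rabs_mult.
      assert (H4 : 0 < 4 * q * s ^ 2)
        by (apply Rmult_lt_0_compat; [lra|now apply pow_lt]).
      assert (H5 : 4 * q * s ^ 2 <= 4 * q * sin (t / 2) ^ 2).
      { apply Rmult_le_compat_l; [lra|]. apply pow_incr. lra. }
      apply Rmult_le_compat.
      + apply Rmult_le_pos; apply Rabs_pos.
      + apply Rabs_pos.
      + pose proof (Rabs_pos (cos (q * t))). pose proof (Rabs_pos (cos (t / 2))).
        assert (forall y, Rabs (cos y) <= 1) as Hc.
        { intros y. apply Rabs_le. apply COS_bound. }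
        pose proof (Hc (q * t)). pose proof (Hc (t / 2)). nra.
      + rewrite Rabs_inv, Rabs_pos_eq by lra. apply Rinv_le_contravar; lra. }
  assert (Hpi0 : f PI = 0).
  { unfold f, sawtooth_defect.
    rewrite (sum_n_ext _ (fun _ => 0)).
    - rewrite sum_n_const.
      replace (cos (q * PI)) with 0.
      { rewrite Rmult_0_r. unfold Rdiv. ring. }
      (* q PI is an odd multiple of PI / 2 *)
      symmetry. apply cos_eq_0_1. exists (Z.of_nat (S N)).
      rewrite <- INR_IZR_INZ, S_INR. unfold q. field.
    - intros k. rewrite sin_eq_0_1; [apply Rmult_0_l|].
      exists (Z.of_nat (S k)). now rewrite <- INR_IZR_INZ. }
  rewrite Hpi0 in Hf. unfold f in Hf.
  specialize (Hsin x Hx).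
  assert (Hcos : Rabs (cos (q * x) / (2 * q * sin (x / 2))) <= 1 / (2 * q * s)).
  { unfold Rdiv at 1. rewrite Rabs_mult.
    assert (0 < 2 * q * s) by nra.
    assert (2 * q * s <= 2 * q * sin (x / 2)) by nra.
    apply Rmult_le_compat; try apply Rabs_pos.
    - apply Rabs_le. apply COS_bound.
    - rewrite Rabs_inv, Rabs_pos_eq by lra. apply Rinv_le_contravar; lra. }
  assert (Hlast : 1 / (4 * q * s ^ 2) * (PI - x) <= 1 / (4 * q * s ^ 2) * PI).
  { apply Rmult_le_compat_l; [|lra]. apply Rdiv_le_0_compat; [lra|].
    apply Rmult_lt_0_compat; [lra|now apply pow_lt]. }
  replace ((PI / (4 * s ^ 2) + 1 / (2 * s)) / q)
    with (1 / (4 * q * s ^ 2) * PI + 1 / (2 * q * s)) by (field; lra).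
  apply Rabs_le. apply Rabs_le_between in Hf, Hcos. split; lra.
Qed.

(** Telescoping, from [2 / (j + 1)^2 <= 2 / j - 2 / (j + 1)]. *)
Lemma parabola_defect_tail (N M : nat) (x : R) :
  (N <= M)%nat ->
  Rabs (parabola_defect M x - parabola_defect N x) <= 2 / INR (S N).
Proof.
  intros HNM.
  (* the sharper bound is what the induction on M preserves *)
  assert (K : Rabs (parabola_defect M x - parabola_defect N x)
     <= 2 / INR (S N) - 2 / INR (S M)).
  { induction HNM as [|M HNM IH].
    - rewrite Rminus_diag, Rabs_R0. lra.
    - replace (parabola_defect (S M) x - parabola_defect N x)
        with ((1 - cos (INR (S (S M)) * x)) / INR (S (S M)) ^ 2
          + (parabola_defect M x - parabola_defect N x)).
      2:{ unfold parabola_defect. rewrite (sum_Sn _ M). unfold plus; cbn -[INR sum_n pow].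
          ring. }
      eapply Rle_trans; [apply Rabs_triang|].
      assert (H1 := INR_S_pos M).
      assert (H2 : INR (S (S M)) = INR (S M) + 1) by apply S_INR.
      assert (HT : Rabs ((1 - cos (INR (S (S M)) * x)) / INR (S (S M)) ^ 2)
         <= 2 / INR (S M) - 2 / INR (S (S M))).
      { pose proof (COS_bound (INR (S (S M)) * x)) as B.
        rewrite H2 in *. set (m := INR (S M)) in *. clearbody m.
        rewrite Rabs_pos_eq by (apply Rdiv_le_0_compat; [lra|apply pow_lt; lra]).
        replace (2 / m - 2 / (m + 1)) with (2 * (m + 1) / m / (m + 1) ^ 2) by (field; lra).
        apply Rmult_le_compat_r.
        - left. apply Rinv_0_lt_compat, pow_lt. lra.
        - apply Rle_div_r; [lra|]. nra. }
      lra. }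
  pose proof (INR_S_pos M).
  assert (0 < 2 / INR (S M)) by (apply Rdiv_lt_0_compat; lra). lra.
Qed.

Lemma parabola_defect_0 (N : nat) : parabola_defect N 0 = 0.
Proof.
  unfold parabola_defect. rewrite (sum_n_ext _ (fun _ => 0)).
  - rewrite sum_n_const, Rmult_0_r. field.
  - intros k. rewrite Rmult_0_r, cos_0, Rminus_diag. apply Rmult_0_l.
Qed.

Lemma parabola_defect_sym (N : nat) (x : R) :
  parabola_defect N (2 * PI - x) = parabola_defect N x.
Proof.
  unfold parabola_defect. f_equal; [|field].
  apply sum_n_ext. intros k.
  replace (INR (S k) * (2 * PI - x)) with (- (INR (S k) * x) + 2 * INR (S k) * PI) by ring.
  now rewrite cos_period, cos_neg.
Qed.

(** By [parabola_defect_tail] it is enough that the defect at each fixed [x] tends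
    to 0.  By symmetry take [0 < x <= PI].  Between a small [d > 0] and [x] the
    defect of index [M] varies by [O(1/M)] ([sawtooth_defect_bound]); at [d] it is
    within [2 / (K + 1)] of the defect of a fixed index [K], which is continuous
    and vanishes at 0. *)
Lemma parabola_defect_bound (N : nat) (x : R) :
  0 <= x <= 2 * PI -> Rabs (parabola_defect N x) <= 2 / INR (S N).
Proof.
  assert (Hpi := PI_RGT_0).
  assert (Hhalf : forall x, 0 < x <= PI -> Rabs (parabola_defect N x) <= 2 / INR (S N)).
  { clear x. intros x Hx. apply le_epsilon. intros e He.
    destruct (exists_nat_ge (2 / (e / 3))) as [K HK].
    assert (HK' : 2 / INR (S K) <= e / 3).
    { pose proof (INR_S_pos K). apply Rle_div_l; [lra|].
      apply Rle_div_l in HK; [|lra]. rewrite S_INR. lra. }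
    (* d depends on K, and M below depends on both *)
    assert (Hd : exists d, 0 < d <= x /\ Rabs (parabola_defect K d) <= e / 3).
    { assert (Hc : continuous (parabola_defect K) 0).
      { apply (ex_derive_continuous (V := R_NormedModule)).
        eexists. apply is_derive_parabola_defect. }
      assert (He3 : 0 < e / 3) by lra.
      destruct (proj1 (filterlim_locally _ _) Hc (mkposreal _ He3)) as [r Hr].
      pose proof (cond_pos r) as Hr0.
      exists (Rmin x (r / 2)).
      assert (0 < Rmin x (r / 2)) by (apply Rmin_pos; lra).
      pose proof (Rmin_l x (r / 2)). pose proof (Rmin_r x (r / 2)).
      split; [lra|]. left.
      specialize (Hr (Rmin x (r / 2))).
      rewrite parabola_defect_0 in Hr.
      unfold ball in Hr; cbn -[parabola_defect] in Hr.
      unfold AbsRing_ball, abs, minus, plus, opp in Hr; cbn -[parabola_defect] in Hr.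
      rewrite Ropp_0, !Rplus_0_r in Hr. apply Hr.
      rewrite Rabs_pos_eq; lra. }
    destruct Hd as [d [Hd HdK]].
    destruct (sawtooth_defect_bound d) as [C HC]; [lra|].
    destruct (exists_nat_ge (PI * Rabs C / (e / 3))) as [M0 HM0].
    set (M := Nat.max M0 (Nat.max N K)).
    assert (HM : PI * Rabs C / (INR M + 3 / 2) <= e / 3).
    { assert (INR M0 <= INR M) by (apply le_INR; lia).
      pose proof (pos_INR M). apply Rle_div_l; [lra|].
      apply Rle_div_l in HM0; [|lra]. nra. }
    pose proof (parabola_defect_tail N M x ltac:(lia)) as T1.
    pose proof (parabola_defect_tail K M d ltac:(lia)) as T2.
    assert (T3 : Rabs (parabola_defect M x - parabola_defect M d)
        <= Rabs C / (INR M + 3 / 2) * (x - d)).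
    { apply abs_increment_le with (df := sawtooth_defect M).
      - lra.
      - intros t _. apply is_derive_parabola_defect.
      - intros t Ht. eapply Rle_trans; [apply HC; lra|].
        pose proof (pos_INR M). apply Rmult_le_compat_r.
        + left. apply Rinv_0_lt_compat. lra.
        + apply Rle_abs. }
    assert (T4 : Rabs C / (INR M + 3 / 2) * (x - d) <= PI * Rabs C / (INR M + 3 / 2)).
    { replace (PI * Rabs C / (INR M + 3 / 2)) with (Rabs C / (INR M + 3 / 2) * PI)
        by (unfold Rdiv; ring).
      apply Rmult_le_compat_l; [|lra]. pose proof (pos_INR M).
      apply Rdiv_le_0_compat; [apply Rabs_pos|lra]. }
    apply Rabs_le. apply Rabs_le_between in T1, T2, T3, HdK. split; lra. }
  intros Hx. destruct (Req_dec x 0) as [->|H0].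
  - rewrite parabola_defect_0, Rabs_R0.
    pose proof (INR_S_pos N). apply Rdiv_le_0_compat; lra.
  - destruct (Rle_dec x PI) as [H1|H1]; [apply Hhalf; lra|].
    destruct (Req_dec x (2 * PI)) as [->|H2].
    + rewrite <- parabola_defect_sym, Rminus_diag, parabola_defect_0, Rabs_R0.
      pose proof (INR_S_pos N). apply Rdiv_le_0_compat; lra.
    + rewrite <- parabola_defect_sym. apply Hhalf. lra.
Qed.

(** * Euler-Maclaurin summation in the logarithmic variable *)

Definition frequency (b : R) (j : nat) : R := 2 * PI * INR (S j) / ln b.

Definition log_sawtooth (b : R) (N : nat) (t : R) : R :=
  sum_n (fun j => sin (frequency b j * ln t) / frequency b j) N.

(** The bound of [parabola_defect_bound] after rescaling the period [2 PI] to
    [ln b]. *)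
Definition Fourier_error (b : R) (N : nat) : R :=
  (ln b / (2 * PI)) ^ 2 * (2 / INR (S N)).

Lemma ln_pos (b : R) : 1 < b -> 0 < ln b.
Proof. intros hb. rewrite <- ln_1. apply ln_increasing; lra. Qed.

Lemma frequency_pos (b : R) (j : nat) : 1 < b -> 0 < frequency b j.
Proof.
  intros hb. pose proof (INR_S_pos j). pose proof PI_RGT_0. pose proof (ln_pos b hb).
  apply Rdiv_lt_0_compat; [|lra]. apply Rmult_lt_0_compat; lra.
Qed.

Lemma continuous_log_sawtooth_exp (b : R) (N : nat) (t : R) :
  1 < b -> 0 < t -> continuous (fun t => log_sawtooth b N t * exp (- t)) t.
Proof.
  intros hb Ht. apply (continuous_mult (K := R_AbsRing)).
  - apply (ex_derive_continuous (V := R_NormedModule)). eexists.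
    apply (is_derive_sum_n (V := R_NormedModule)
      (fun j t => sin (frequency b j * ln t) / frequency b j) N t
      (fun j => cos (frequency b j * ln t) / t)).
    intros k _. pose proof (frequency_pos b k hb) as Hy.
    set (y := frequency b k) in *. clearbody y.
    auto_derive; [lra|]. field. lra.
  - apply (ex_derive_continuous (V := R_NormedModule)). auto_derive. exact I.
Qed.

Lemma ex_RInt_log_sawtooth_exp (b : R) (N : nat) (u v : R) :
  1 < b -> 0 < u <= v -> ex_RInt (fun t => log_sawtooth b N t * exp (- t)) u v.
Proof.
  intros hb H. apply ex_RInt_continuous_on; [lra|].
  intros t Ht. apply continuous_log_sawtooth_exp; lra.
Qed.

(** Since [ln a] is a multiple of the period, [ln t] may be replaced by
    [ln t - ln a] inside the sines; then rescale the period to [2 PI]. *)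
Lemma log_sawtooth_on_period (b : R) (N : nat) (a t : R) (k : Z) :
  1 < b -> ln a = IZR k * ln b ->
  log_sawtooth b N t - (ln b / 4 - (ln t - ln a) / 2)
  = ln b / (2 * PI) * sawtooth_defect N (2 * PI / ln b * (ln t - ln a)).
Proof.
  intros hb Ha. pose proof (ln_pos b hb) as HL. pose proof PI_RGT_0 as Hpi.
  unfold sawtooth_defect. rewrite Rmult_minus_distr_l. f_equal; [|field; lra].
  unfold log_sawtooth.
  rewrite <- (sum_n_mult_l (K := R_Ring)).
  apply sum_n_ext. intros j. unfold mult; cbn -[INR].
  pose proof (INR_S_pos j) as Hj.
  replace (sin (INR (S j) * (2 * PI / ln b * (ln t - ln a))))
    with (sin (frequency b j * ln t)).
  - unfold frequency. field. lra.
  - replace (INR (S j) * (2 * PI / ln b * (ln t - ln a)))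
      with (frequency b j * ln t - IZR (Z.of_nat (S j) * k) * (2 * PI)).
    + rewrite sin_minus.
      set (n := (Z.of_nat (S j) * k)%Z).
      rewrite (sin_eq_0_1 (IZR n * (2 * PI))).
      2:{ exists (2 * n)%Z. rewrite mult_IZR. ring. }
      replace (cos (IZR n * (2 * PI))) with 1; [ring|].
      replace (IZR n * (2 * PI)) with (2 * (IZR n * PI)) by ring.
      rewrite cos_2a_sin, (sin_eq_0_1 (IZR n * PI)) by now exists n. ring.
    + rewrite Ha, mult_IZR, <- INR_IZR_INZ. unfold frequency. field. lra.
Qed.

(** Let [W] be the rescaled parabola defect, which vanishes at both ends, and [s]
    the sawtooth [L / 4 - (ln t - ln a) / 2].  The derivative of
    [W t exp (- t) - s exp (- t)] is
    [D + exp (- t) / (2 t) + W (1 - t) exp (- t)], where [D] is the first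
    integrand.  So the quantity to bound is minus the integral of the last term,
    and [|1 - t| exp (- t) <= (1 + t) exp (- t)] has the antiderivative
    [- (2 + t) exp (- t)]. *)
Lemma Euler_Maclaurin_period (b : R) (N : nat) (a : R) (k : Z) :
  1 < b -> 0 < a -> ln a = IZR k * ln b ->
  Rabs (RInt (fun t => log_sawtooth b N t * exp (- t)) a (a * b)
        + RInt (fun t => exp (- t) / t) a (a * b) / 2
        - ln b / 4 * (exp (- a) + exp (- (a * b))))
  <= Fourier_error b N * ((2 + a) * exp (- a) - (2 + a * b) * exp (- (a * b))).
Proof.
  intros hb Ha Hk. pose proof (ln_pos b hb) as HL. pose proof PI_RGT_0 as Hpi.
  set (L := ln b) in *. set (e := Fourier_error b N).
  assert (Hab : a <= a * b) by nra.
  set (W := fun t => (L / (2 * PI)) ^ 2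
    * parabola_defect N (2 * PI / L * (ln t - ln a))).
  assert (HWa : W a = 0).
  { unfold W. rewrite Rminus_diag, Rmult_0_r, parabola_defect_0. ring. }
  assert (Hlnab : ln (a * b) = ln a + L) by (apply ln_mult; lra).
  assert (HWb : W (a * b) = 0).
  { unfold W. rewrite Hlnab.
    replace (2 * PI / L * (ln a + L - ln a)) with (2 * PI - 0) by (field; lra).
    rewrite parabola_defect_sym, parabola_defect_0. ring. }
  assert (HWd : forall t, 0 < t -> is_derive W t
     ((log_sawtooth b N t - (L / 4 - (ln t - ln a) / 2)) / t)).
  { intros t Ht. unfold L. rewrite (log_sawtooth_on_period b N a t k hb Hk). fold L.
    set (s := sawtooth_defect N (2 * PI / L * (ln t - ln a))).
    replace (L / (2 * PI) * s / t)
      with ((L / (2 * PI)) ^ 2 * (2 * PI / L * / t * s)) by (field; lra).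
    apply is_derive_scal.
    apply (is_derive_comp (V := R_NormedModule) (parabola_defect N)
      (fun t => 2 * PI / L * (ln t - ln a))).
    - apply is_derive_parabola_defect.
    - auto_derive; [lra|]. field. lra. }
  assert (HWbd : forall t, a <= t <= a * b -> Rabs (W t) <= e).
  { intros t Ht. unfold W, e, Fourier_error. fold L.
    rewrite Rabs_mult, Rabs_pos_eq by apply pow2_ge_0.
    apply Rmult_le_compat_l; [apply pow2_ge_0|].
    apply parabola_defect_bound.
    assert (H1 : ln a <= ln t) by (apply ln_le; lra).
    assert (H2 : ln t <= ln a + L) by (rewrite <- Hlnab; apply ln_le; lra).
    assert (H3 : 0 < 2 * PI / L) by (apply Rdiv_lt_0_compat; lra).
    assert (H4 : 2 * PI / L * L = 2 * PI) by (field; lra).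
    set (c := 2 * PI / L) in *. clearbody c.
    split; [apply Rmult_le_pos; lra|].
    rewrite <- H4. apply Rmult_le_compat_l; lra. }
  set (D := fun t => log_sawtooth b N t * exp (- t)).
  set (E := fun t => exp (- t) / t).
  set (Q := fun t => W t * ((1 - t) * exp (- t))).
  assert (HcD : forall t, 0 < t -> continuous D t)
    by (intros t Ht; now apply continuous_log_sawtooth_exp).
  assert (HcE : forall t, 0 < t -> continuous E t)
    by (intros t Ht; now apply continuous_exp_div).
  assert (HcQ : forall t, 0 < t -> continuous Q t).
  { intros t Ht. apply (continuous_mult (K := R_AbsRing)).
    - apply (ex_derive_continuous (V := R_NormedModule)). eexists. now apply HWd.
    - apply (ex_derive_continuous (V := R_NormedModule)). auto_derive. exact I. }
  assert (HxD : is_RInt D a (a * b) (RInt D a (a * b))).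
  { apply (RInt_correct (V := R_CompleteNormedModule)), ex_RInt_continuous_on; [lra|].
    intros t Ht. apply HcD. lra. }
  assert (HxE : is_RInt E a (a * b) (RInt E a (a * b))).
  { apply (RInt_correct (V := R_CompleteNormedModule)), ex_RInt_continuous_on; [lra|].
    intros t Ht. apply HcE. lra. }
  assert (HxQ : is_RInt Q a (a * b) (RInt Q a (a * b))).
  { apply (RInt_correct (V := R_CompleteNormedModule)), ex_RInt_continuous_on; [lra|].
    intros t Ht. apply HcQ. lra. }
  set (F := fun t => W t * (t * exp (- t)) - (L / 4 - (ln t - ln a) / 2) * exp (- t)).
  assert (HF : is_RInt (fun t => D t + / 2 * E t + Q t) a (a * b) (F (a * b) - F a)).
  { apply is_RInt_antiderivative.
    - exact Hab.
    - intros t Ht. unfold F.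
      replace (D t + / 2 * E t + Q t) with
        (minus (plus ((log_sawtooth b N t - (L / 4 - (ln t - ln a) / 2)) / t * (t * exp (- t)))
          (W t * ((1 - t) * exp (- t))))
          (- / 2 * exp (- t) / t - (L / 4 - (ln t - ln a) / 2) * exp (- t))).
      2:{ unfold minus, plus, opp, D, E, Q; cbn -[W log_sawtooth]. field. lra. }
      apply (is_derive_minus (V := R_NormedModule)).
      + apply (is_derive_mult W (fun t => t * exp (- t))).
        * apply HWd. lra.
        * auto_derive; [exact I|]. ring.
        * intros; apply Rmult_comm.
      + auto_derive; [lra|]. field. lra.
    - intros t Ht. apply (continuous_plus (V := R_NormedModule)).
      + apply (continuous_plus (V := R_NormedModule)); [apply HcD; lra|].
        apply (continuous_scal_r (V := R_NormedModule) (/ 2)). apply HcE. lra.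
      + apply HcQ. lra. }
  assert (HG : is_RInt (fun t => D t + / 2 * E t + Q t) a (a * b)
     (RInt D a (a * b) + / 2 * RInt E a (a * b) + RInt Q a (a * b))).
  { apply (is_RInt_plus (V := R_NormedModule)); [|exact HxQ].
    apply (is_RInt_plus (V := R_NormedModule)); [exact HxD|].
    apply (is_RInt_scal (V := R_NormedModule)). exact HxE. }
  assert (Heq : F (a * b) - F a
     = RInt D a (a * b) + / 2 * RInt E a (a * b) + RInt Q a (a * b)).
  { rewrite <- (is_RInt_unique _ _ _ _ HF). apply (is_RInt_unique _ _ _ _ HG). }
  unfold F in Heq. rewrite HWa, HWb, Hlnab in Heq.
  replace (RInt D a (a * b) + RInt E a (a * b) / 2 - L / 4 * (exp (- a) + exp (- (a * b))))
    with (- RInt Q a (a * b)) by lra.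
  rewrite Rabs_Ropp.
  replace (e * ((2 + a) * exp (- a) - (2 + a * b) * exp (- (a * b))))
    with ((- e * ((2 + a * b) * exp (- (a * b)))) - (- e * ((2 + a) * exp (- a)))) by ring.
  apply (RInt_abs_le_antiderivative Q (fun t => - e * ((2 + t) * exp (- t)))
    (fun t => e * ((1 + t) * exp (- t)))).
  - exact Hab.
  - intros t _. auto_derive; [exact I|]. ring.
  - intros t _. apply (ex_derive_continuous (V := R_NormedModule)). auto_derive. exact I.
  - eexists. exact HxQ.
  - intros t Ht. unfold Q. rewrite Rabs_mult, Rabs_mult.
    pose proof (exp_pos (- t)) as He.
    rewrite (Rabs_pos_eq (exp (- t))) by lra.
    apply Rmult_le_compat.
    + apply Rabs_pos.
    + apply Rmult_le_pos; [apply Rabs_pos|lra].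
    + now apply HWbd.
    + apply Rmult_le_compat_r; [lra|]. apply Rabs_le. lra.
Qed.

Definition double_exp_term (b : R) (j : nat) : R :=
  exp (- (1 / b ^ j)) - 1 + exp (- b ^ j).

(** Half the trapezoidal sum of [exp (- exp u)] with step [ln b] over
    the interval [- M ln b, M ln b].  The terms of positive and negative index
    are paired, which counts the central value [/ exp 1] twice; the [M + 1]
    compensates the [-1] in each [double_exp_term]. *)
Definition half_trapezoid_sum (b : R) (M : nat) : R :=
  ln b / 2 * (sum_n (double_exp_term b) M + INR M + 1 - / exp 1)
  - ln b / 4 * (exp (- / b ^ M) + exp (- b ^ M)).

Lemma ln_pow_nat (b : R) (M : nat) : 0 < b -> ln (b ^ M) = INR M * ln b.
Proof.
  intros hb. induction M as [|M IH].
  - simpl. rewrite ln_1. ring.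
  - rewrite S_INR. simpl. rewrite ln_mult, IH; [ring|lra|now apply pow_lt].
Qed.

(** Adding one period at each end of the interval; the bounds telescope, which
    keeps the total independent of [M]. *)
Lemma Euler_Maclaurin (b : R) (N M : nat) :
  1 < b ->
  Rabs (RInt (fun t => log_sawtooth b N t * exp (- t)) (/ b ^ M) (b ^ M)
        + RInt (fun t => exp (- t) / t) (/ b ^ M) (b ^ M) / 2
        - half_trapezoid_sum b M)
  <= 2 * Fourier_error b N.
Proof.
  intros hb. pose proof (ln_pos b hb) as HL.
  set (psi := fun t => (2 + t) * exp (- t)).
  (* the induction needs the sharper bound that telescopes *)
  enough (K : Rabs (RInt (fun t => log_sawtooth b N t * exp (- t)) (/ b ^ M) (b ^ M)
        + RInt (fun t => exp (- t) / t) (/ b ^ M) (b ^ M) / 2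
        - half_trapezoid_sum b M)
     <= Fourier_error b N * (psi (/ b ^ M) - psi (b ^ M))).
  { eapply Rle_trans; [exact K|]. rewrite Rmult_comm.
    assert (0 < b ^ M) by (apply pow_lt; lra).
    apply Rmult_le_compat_r.
    - apply Rmult_le_pos; [apply pow2_ge_0|].
      apply Rdiv_le_0_compat; [lra|apply INR_S_pos].
    - unfold psi. pose proof (exp_pos (- b ^ M)).
      assert (H1 : 0 < / b ^ M) by now apply Rinv_0_lt_compat.
      assert (H2 : forall x, 0 < x -> (2 + x) * exp (- x) <= 2).
      { intros x Hx. pose proof (exp_ineq1_le x). pose proof (exp_pos (- x)).
        assert (exp x * exp (- x) = 1) by (rewrite <- exp_plus, Rplus_opp_r; apply exp_0).
        nra. }
      specialize (H2 _ H1). nra. }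
  induction M as [|M IH].
  - simpl pow. rewrite Rinv_1, !RInt_point. unfold zero; cbn -[half_trapezoid_sum].
    unfold half_trapezoid_sum, double_exp_term. rewrite sum_O. simpl.
    replace (1 / 1) with 1 by field. rewrite Rinv_1, exp_Ropp.
    match goal with |- Rabs ?x <= _ => replace x with 0
      by (field; apply Rgt_not_eq, exp_pos) end.
    rewrite Rabs_R0. lra.
  - assert (HbM : 1 <= b ^ M) by (apply pow_R1_Rle; lra).
    assert (HiM : 0 < / b ^ M <= 1).
    { split; [apply Rinv_0_lt_compat; lra|]. rewrite <- Rinv_1. apply Rinv_le_contravar; lra. }
    assert (E1 : / b ^ M = / b ^ S M * b) by (simpl; field; lra).
    assert (E2 : b ^ S M = b ^ M * b) by (simpl; ring).
    assert (H3 : 0 < / b ^ S M) by (apply Rinv_0_lt_compat, pow_lt; lra).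
    assert (H4 : / b ^ S M <= / b ^ M) by nra.
    assert (H5 : b ^ M <= b ^ S M) by nra.
    pose proof (Euler_Maclaurin_period b N (b ^ M) (Z.of_nat M) hb ltac:(lra)) as P1.
    rewrite ln_pow_nat, <- INR_IZR_INZ, <- E2 in P1 by lra. specialize (P1 eq_refl).
    pose proof (Euler_Maclaurin_period b N (/ b ^ S M) (- Z.of_nat (S M)) hb H3) as P2.
    rewrite ln_Rinv, ln_pow_nat, opp_IZR, <- INR_IZR_INZ, <- E1 in P2
      by (try apply pow_lt; lra).
    specialize (P2 ltac:(ring)).
    assert (C : forall f, (forall u v, 0 < u <= v -> ex_RInt f u v) ->
      RInt f (/ b ^ S M) (b ^ S M) = RInt f (/ b ^ S M) (/ b ^ M)
        + RInt f (/ b ^ M) (b ^ M) + RInt f (b ^ M) (b ^ S M)).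
    { intros f Hf.
      rewrite <- (RInt_Chasles (V := R_CompleteNormedModule) f _ (b ^ M) (b ^ S M))
        by (apply Hf; lra).
      rewrite <- (RInt_Chasles (V := R_CompleteNormedModule) f _ (/ b ^ M) (b ^ M))
        by (apply Hf; lra).
      reflexivity. }
    rewrite (C (fun t => log_sawtooth b N t * exp (- t)))
      by (intros; apply ex_RInt_log_sawtooth_exp; assumption).
    rewrite (C (fun t => exp (- t) / t)) by (intros; apply ex_RInt_exp_div; assumption).
    assert (T : half_trapezoid_sum b (S M) = half_trapezoid_sum b M
      + ln b / 4 * (exp (- b ^ M) + exp (- b ^ S M))
      + ln b / 4 * (exp (- / b ^ S M) + exp (- / b ^ M))).
    { unfold half_trapezoid_sum. rewrite sum_Sn, S_INR. unfold plus; cbn -[sum_n pow INR].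
      unfold double_exp_term at 2.
      replace (1 / b ^ S M) with (/ b ^ S M) by (unfold Rdiv; ring). field.
      apply Rgt_not_eq, exp_pos. }
    rewrite T. unfold psi in *.
    apply Rabs_le. apply Rabs_le_between in IH, P1, P2. split; lra.
Qed.

(** * The Gamma function on the imaginary axis *)

(** Cauchy's criterion: changing the bounds of integration from [(a1, b1)] to
    [(a2, b2)] changes the integral by at most
    [|exp (- a1) - exp (- a2)| + |exp (- b1) - exp (- b2)|]. *)
Lemma ex_RInt_gen_exp_dominated (f : R -> R) :
  (forall t, 0 < t -> continuous f t) ->
  (forall t, 0 < t -> Rabs (f t) <= exp (- t)) ->
  exists l : R, is_RInt_gen (V := R_NormedModule) f (at_right 0) (Rbar_locally p_infty) l.
Proof.
  intros Hc Hb.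
  assert (Hex : forall u v, 0 < u -> 0 < v -> ex_RInt f u v).
  { intros u v Hu Hv. apply (ex_RInt_continuous (V := R_CompleteNormedModule)).
    intros t [Ht _]. apply Hc. eapply Rlt_le_trans; [|exact Ht]. now apply Rmin_pos. }
  assert (Hint : forall u v, 0 < u <= v -> Rabs (RInt f u v) <= exp (- u) - exp (- v)).
  { intros u v H. replace (exp (- u) - exp (- v)) with (- exp (- v) - - exp (- u)) by ring.
    apply (RInt_abs_le_antiderivative f (fun t => - exp (- t)) (fun t => exp (- t))).
    - lra.
    - intros t _. auto_derive; [exact I|ring].
    - intros t _. apply (ex_derive_continuous (V := R_NormedModule)). auto_derive. exact I.
    - apply Hex; lra.
    - intros t Ht. apply Hb. lra. }
  assert (Hsym : forall u v, 0 < u -> 0 < v ->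
     Rabs (RInt f u v) <= Rabs (exp (- u) - exp (- v))).
  { intros u v Hu Hv. destruct (Rle_dec u v) as [H|H].
    - eapply Rle_trans; [apply Hint; lra|]. apply Rle_abs.
    - rewrite <- (opp_RInt_swap (V := R_CompleteNormedModule)) by (apply Hex; lra).
      unfold opp; cbn. rewrite Rabs_Ropp, Rabs_minus_sym.
      eapply Rle_trans; [apply Hint; lra|]. apply Rle_abs. }
  destruct (proj1 (filterlim_locally_cauchy (U := R_CompleteSpace)
    (F := filter_prod (at_right 0) (Rbar_locally p_infty))
    (fun ab => RInt f (fst ab) (snd ab)))) as [l Hl].
  - intros [e He].
    exists (fun ab => 0 < fst ab < e / 4 /\ 4 / e < snd ab). split.
    + apply Filter_prod with (fun x => 0 < x < e / 4) (fun x => 4 / e < x).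
      * assert (H4 : 0 < e / 4) by lra. exists (mkposreal _ H4).
        intros y Hy Hy0. unfold ball in Hy; cbn in Hy.
        unfold AbsRing_ball, abs, minus, plus, opp in Hy; cbn in Hy.
        rewrite Ropp_0, Rplus_0_r in Hy. apply Rabs_def2 in Hy. lra.
      * exists (4 / e). intros x Hx. exact Hx.
      * intros x y Hx Hy. split; assumption.
    + intros [a1 b1] [a2 b2]; cbn [fst snd]. intros [Ha1 Hb1] [Ha2 Hb2].
      assert (0 < 4 / e) by (apply Rdiv_lt_0_compat; lra).
      assert (Hs : RInt f a2 b2 - RInt f a1 b1 = RInt f a2 a1 + RInt f b1 b2).
      { rewrite <- (RInt_Chasles (V := R_CompleteNormedModule) f a2 a1 b2) by (apply Hex; lra).
        rewrite <- (RInt_Chasles (V := R_CompleteNormedModule) f a1 b1 b2) by (apply Hex; lra).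
        unfold plus; cbn. ring. }
      change (Rabs (RInt f a2 b2 - RInt f a1 b1) < e). rewrite Hs.
      assert (Hsmall : forall x, 0 < x < e / 4 -> 1 - e / 4 < exp (- x) < 1).
      { intros x Hx. split.
        - pose proof (exp_ineq1_le (- x)). lra.
        - rewrite <- exp_0. apply exp_increasing. lra. }
      assert (Hlarge : forall x, 4 / e < x -> 0 < exp (- x) < e / 4).
      { intros x Hx. split; [apply exp_pos|].
        pose proof (exp_ineq1_le x). rewrite exp_Ropp.
        replace (e / 4) with (/ (4 / e)) by (field; lra).
        apply Rinv_lt_contravar; [|lra].
        apply Rmult_lt_0_compat; [lra|]. apply exp_pos. }
      pose proof (Hsym a2 a1 ltac:(lra) ltac:(lra)) as S1.
      pose proof (Hsym b1 b2 ltac:(lra) ltac:(lra)) as S2.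
      pose proof (Hsmall _ Ha1). pose proof (Hsmall _ Ha2).
      pose proof (Hlarge _ Hb1). pose proof (Hlarge _ Hb2).
      assert (Rabs (exp (- a2) - exp (- a1)) <= e / 4) by (apply Rabs_le; lra).
      assert (Rabs (exp (- b1) - exp (- b2)) <= e / 4) by (apply Rabs_le; lra).
      eapply Rle_lt_trans; [apply Rabs_triang|]. lra.
  - exists l. intros P HP.
    unfold filtermapi.
    apply (filter_imp (fun ab => (0 < fst ab /\ 0 < snd ab)
       /\ P (RInt f (fst ab) (snd ab)))).
    + intros [u v] [[Hu Hv] HPuv]. exists (RInt f u v). split; [|exact HPuv].
      apply (RInt_correct (V := R_CompleteNormedModule)). now apply Hex.
    + apply filter_and.
      * apply Filter_prod with (fun x => 0 < x) (fun x => 0 < x).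
        -- exists (mkposreal 1 Rlt_0_1). intros y _ Hy. exact Hy.
        -- exists 0. intros x Hx. exact Hx.
        -- intros x y Hx Hy. split; assumption.
      * apply Hl. exact HP.
Qed.

Lemma is_RInt_gen_pair (Fa Fb : (R -> Prop) -> Prop) {FFa : Filter Fa} {FFb : Filter Fb}
  (f : R -> C) (lr li : R) :
  is_RInt_gen (V := R_NormedModule) (fun t => fst (f t)) Fa Fb lr ->
  is_RInt_gen (V := R_NormedModule) (fun t => snd (f t)) Fa Fb li ->
  is_RInt_gen (V := C_R_NormedModule) f Fa Fb (lr, li).
Proof.
  intros Hr Hi P [e He].
  assert (Br : locally lr (ball lr e)) by apply locally_ball.
  assert (Bi : locally li (ball li e)) by apply locally_ball.
  specialize (Hr _ Br). specialize (Hi _ Bi).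
  unfold filtermapi in *. generalize (filter_and _ _ Hr Hi). apply filter_imp.
  intros [u v] [[y1 [I1 B1]] [y2 [I2 B2]]]. exists (y1, y2). split.
  - now apply (is_RInt_fct_extend_pair (U := R_NormedModule) (V := R_NormedModule)).
  - apply He. split; assumption.
Qed.

Lemma is_RInt_gen_lim_seq (f : R -> R) (l : R) (u v : nat -> R) :
  is_RInt_gen (V := R_NormedModule) f (at_right 0) (Rbar_locally p_infty) l ->
  is_lim_seq u 0 -> (forall n, 0 < u n) -> is_lim_seq v p_infty ->
  is_lim_seq (fun n => RInt f (u n) (v n)) l.
Proof.
  intros Hf Hu Hu0 Hv.
  assert (Huv : filterlim (fun n => (u n, v n)) eventually
     (filter_prod (at_right 0) (Rbar_locally p_infty))).
  { apply filterlim_pair; [|exact Hv].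
    intros P HP. generalize (Hu _ HP). unfold filtermap. apply filter_imp.
    intros n Hn. apply Hn, Hu0. }
  intros P HP. specialize (Huv _ (Hf P HP)). revert Huv. unfold filtermap.
  apply filter_imp. intros n [y [Hy HPy]]. cbn in Hy.
  now rewrite (is_RInt_unique (V := R_CompleteNormedModule) _ _ _ _ Hy).
Qed.

(** On the imaginary axis [CGamma z] is [Euler_integral (z + 1) / z], because
    [up 0 = 1]; dividing by [i y] selects the sine integral. *)
Lemma Re_CGamma_imaginary (y : R) (u v : nat -> R) :
  y <> 0 ->
  is_lim_seq u 0 -> (forall n, 0 < u n) -> is_lim_seq v p_infty ->
  is_lim_seq (fun n => RInt (fun t => sin (y * ln t) / y * exp (- t)) (u n) (v n))
    (Re (CGamma (0, y))).
Proof.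
  intros Hy Hu Hu0 Hv.
  assert (Hdom : forall g, (forall x, Rabs (g x) <= 1) -> (forall x, ex_derive g x) ->
    exists l : R, is_RInt_gen (V := R_NormedModule) (fun t => g (y * ln t) * exp (- t))
      (at_right 0) (Rbar_locally p_infty) l).
  { intros g Hg Hd. apply ex_RInt_gen_exp_dominated.
    - intros t Ht. apply (ex_derive_continuous (V := R_NormedModule)).
      auto_derive. split; [apply Hd|lra].
    - intros t _. rewrite Rabs_mult, (Rabs_pos_eq (exp _)) by (left; apply exp_pos).
      rewrite <- (Rmult_1_l (exp (- t))) at 2.
      apply Rmult_le_compat_r; [left; apply exp_pos|apply Hg]. }
  destruct (Hdom cos) as [lr Hr].
  { intros x. apply Rabs_le, COS_bound. }
  { intros x. auto_derive. exact I. }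
  destruct (Hdom sin) as [li Hi].
  { intros x. apply Rabs_le, SIN_bound. }
  { intros x. auto_derive. exact I. }
  assert (HE : Euler_integral ((0, y) + RtoC 1)%C = (lr, li)).
  { unfold Euler_integral.
    refine (is_RInt_gen_unique (V := C_R_CompleteNormedModule)
      (Fa := at_right 0) (Fb := Rbar_locally p_infty) _ (lr, li) _).
    assert (Eq : forall t, (Rpow_C t ((0, y) + RtoC 1 - 1) * RtoC (exp (- t)))%C
       = (cos (y * ln t) * exp (- t), sin (y * ln t) * exp (- t))).
    { intros t. unfold Rpow_C, Cexp, Cmult, Cminus, Cplus, Copp, RtoC, Re, Im; cbn.
      replace ((0 + 1 + - (1)) * ln t - (y + 0 + - 0) * 0) with 0 by ring.
      replace ((0 + 1 + - (1)) * 0 + (y + 0 + - 0) * ln t) with (y * ln t) by ring.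
      rewrite exp_0. f_equal; ring. }
    apply (is_RInt_gen_ext (V := C_R_NormedModule)
      (fun t => (cos (y * ln t) * exp (- t), sin (y * ln t) * exp (- t)))).
    - apply filter_forall. intros ab t _. symmetry. apply Eq.
    - apply is_RInt_gen_pair; [apply _|apply _|exact Hr|exact Hi]. }
  assert (HG : Re (CGamma (0, y)) = li / y).
  { unfold CGamma. cbn [Re fst].
    replace (Z.to_nat (up (- 0))) with 1%nat.
    - cbn [Crising INR]. rewrite HE.
      unfold Cdiv, Cinv, Cmult, Cplus, RtoC, Re; cbn. field. exact Hy.
    - rewrite <- (tech_up (- 0) 1); [reflexivity|lra|lra]. }
  rewrite HG.
  assert (HL : is_lim_seq
    (fun n => / y * RInt (fun t => sin (y * ln t) * exp (- t)) (u n) (v n)) (/ y * li)).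
  { apply (is_lim_seq_scal_l _ _ (Finite li)). now apply is_RInt_gen_lim_seq. }
  replace (li / y) with (/ y * li) by (unfold Rdiv; ring).
  apply (is_lim_seq_ext_loc _ _ _) with (2 := HL).
  apply filter_imp with (P := fun n => 0 < v n).
  2:{ apply (Hv (fun x => 0 < x)). exists 0. auto. }
  intros n Hn.
  rewrite <- (RInt_scal (V := R_CompleteNormedModule)).
  - apply (RInt_ext (V := R_CompleteNormedModule)). intros t _.
    unfold scal; cbn. unfold mult; cbn. unfold Rdiv. ring.
  - apply (ex_RInt_continuous (V := R_CompleteNormedModule)). intros t [Ht _].
    assert (0 < t) by (eapply Rlt_le_trans; [|exact Ht]; apply Rmin_pos; auto).
    apply (ex_derive_continuous (V := R_NormedModule)). auto_derive. lra.
Qed.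

(** * Passage to the limit *)

Lemma RInt_log_sawtooth (b : R) (N : nat) (u v : R) :
  1 < b -> 0 < u <= v ->
  RInt (fun t => log_sawtooth b N t * exp (- t)) u v
  = sum_n (fun j => RInt (fun t => sin (frequency b j * ln t) / frequency b j
      * exp (- t)) u v) N.
Proof.
  intros hb H. induction N as [|N IH].
  - rewrite sum_O. apply (RInt_ext (V := R_CompleteNormedModule)). intros t _.
    unfold log_sawtooth. now rewrite sum_O.
  - rewrite sum_Sn, <- IH.
    rewrite <- (RInt_plus (V := R_CompleteNormedModule)).
    + apply (RInt_ext (V := R_CompleteNormedModule)). intros t _.
      unfold log_sawtooth. rewrite sum_Sn. apply Rmult_plus_distr_r.
    + now apply ex_RInt_log_sawtooth_exp.
    + apply ex_RInt_continuous_on; [lra|]. intros t Ht.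
      pose proof (frequency_pos b (S N) hb). set (y := frequency b (S N)) in *. clearbody y.
      apply (ex_derive_continuous (V := R_NormedModule)). auto_derive. lra.
Qed.

Lemma is_lim_seq_sum_n (a : nat -> nat -> R) (l : nat -> R) (N : nat) :
  (forall j, is_lim_seq (fun M => a j M) (l j)) ->
  is_lim_seq (fun M => sum_n (fun j => a j M) N) (sum_n l N).
Proof.
  intros Ha. induction N as [|N IH].
  - rewrite sum_O. apply is_lim_seq_ext with (2 := Ha 0%nat).
    intros M. now rewrite sum_O.
  - rewrite sum_Sn. apply is_lim_seq_ext with
      (fun M => sum_n (fun j => a j M) N + a (S N) M).
    + intros M. now rewrite sum_Sn.
    + now apply is_lim_seq_plus'.
Qed.

(** Each of [1 - exp (- 1/b^j)] and [exp (- b^j)] is at most [1/b^j]. *)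
Lemma ex_series_double_exp_term (b : R) : 1 < b -> ex_series (double_exp_term b).
Proof.
  intros hb. apply (ex_series_le (V := R_CompleteNormedModule) _ (fun j => 2 * (/ b) ^ j)).
  - intros j. change (Rabs (double_exp_term b j) <= 2 * (/ b) ^ j).
    rewrite pow_inv. unfold double_exp_term.
    assert (Hx : 0 < b ^ j) by (apply pow_lt; lra).
    replace (1 / b ^ j) with (/ b ^ j) by (unfold Rdiv; ring).
    set (x := b ^ j) in *. clearbody x.
    assert (Hi : 0 < / x) by now apply Rinv_0_lt_compat.
    pose proof (exp_ineq1_le (- / x)). pose proof (exp_le_1 (- / x) ltac:(lra)).
    assert (H2 : exp (- x) <= / x).
    { rewrite exp_Ropp. apply Rinv_le_contravar; [exact Hx|].
      pose proof (exp_ineq1_le x). lra. }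
    pose proof (exp_pos (- x)). apply Rabs_le. lra.
  - apply (ex_series_scal_l (K := R_AbsRing) 2 (fun j => (/ b) ^ j)). apply ex_series_geom.
    rewrite Rabs_pos_eq by (left; apply Rinv_0_lt_compat; lra).
    rewrite <- Rinv_1. apply Rinv_lt_contravar; lra.
Qed.

Lemma is_lim_seq_pow_infty (b : R) : 1 < b -> is_lim_seq (fun M => b ^ M) p_infty.
Proof. intros hb. now apply is_lim_seq_geom_p. Qed.

Lemma is_lim_seq_inv_pow_0 (b : R) : 1 < b -> is_lim_seq (fun M => / b ^ M) 0.
Proof.
  intros hb. apply (is_lim_seq_inv _ p_infty); [now apply is_lim_seq_pow_infty|discriminate].
Qed.

Lemma is_lim_seq_exp_pow_0 (b : R) : 1 < b -> is_lim_seq (fun M => exp (- b ^ M)) 0.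
Proof.
  intros hb. apply is_lim_seq_le_le with (fun _ => 0) (fun M => / b ^ M).
  - intros M. split; [left; apply exp_pos|]. rewrite exp_Ropp.
    apply Rinv_le_contravar; [apply pow_lt; lra|].
    pose proof (exp_ineq1_le (b ^ M)). lra.
  - apply is_lim_seq_const.
  - now apply is_lim_seq_inv_pow_0.
Qed.

(** The [M ln b / 2] in the trapezoidal sum cancels against the logarithmic
    divergence of the exponential integral at 0. *)
Lemma is_lim_seq_half_trapezoid_sum (b : R) :
  1 < b ->
  is_lim_seq
    (fun M => half_trapezoid_sum b M - RInt (fun t => exp (- t) / t) (/ b ^ M) (b ^ M) / 2)
    (ln b / 2 * Series (double_exp_term b) + (1 / 4 - 1 / (2 * exp 1)) * ln b
     + Euler_Mascheroni / 2).
Proof.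
  intros hb.
  set (r := fun M => RInt (fun t => exp (- t) / t) (/ b ^ M) (b ^ M) + ln (/ b ^ M)
     + Euler_Mascheroni).
  assert (Hr : is_lim_seq r 0).
  { apply is_lim_seq_abs_0.
    apply is_lim_seq_le_le with (fun _ => 0) (fun M => / b ^ M + exp (- b ^ M)).
    - intros M. split; [apply Rabs_pos|].
      assert (1 <= b ^ M) by (apply pow_R1_Rle; lra).
      apply exp_integral_Euler_Mascheroni; [|lra].
      split; [apply Rinv_0_lt_compat; lra|].
      apply Rle_trans with (/ 1); [apply Rinv_le_contravar|]; lra.
    - apply is_lim_seq_const.
    - replace 0 with (0 + 0) by ring. apply is_lim_seq_plus'.
      + now apply is_lim_seq_inv_pow_0.
      + now apply is_lim_seq_exp_pow_0. }
  assert (He1 : is_lim_seq (fun M => exp (- / b ^ M)) 1).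
  { rewrite <- exp_0, <- Ropp_0.
    apply (is_lim_seq_continuous exp (fun M => - / b ^ M)).
    - apply derivable_continuous_pt, derivable_pt_exp.
    - apply (is_lim_seq_opp _ (Finite 0)). now apply is_lim_seq_inv_pow_0. }
  assert (Hs : is_lim_seq (sum_n (double_exp_term b)) (Series (double_exp_term b))).
  { apply (Series_correct (double_exp_term b)). now apply ex_series_double_exp_term. }
  apply is_lim_seq_ext with (fun M =>
    ln b / 2 * sum_n (double_exp_term b) M + ln b / 2 * (1 - / exp 1)
    + - (ln b / 4) * (exp (- / b ^ M) + exp (- b ^ M))
    + Euler_Mascheroni / 2 + - / 2 * r M).
  - intros M. unfold half_trapezoid_sum, r.
    rewrite ln_Rinv, ln_pow_nat by (try apply pow_lt; lra).
    field. apply Rgt_not_eq, exp_pos.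
  - replace (ln b / 2 * _ + _ + _) with
      (ln b / 2 * Series (double_exp_term b) + ln b / 2 * (1 - / exp 1)
       + - (ln b / 4) * (1 + 0) + Euler_Mascheroni / 2 + - / 2 * 0)
      by (field; apply Rgt_not_eq, exp_pos).
    assert (Hm : forall k u (l : R), is_lim_seq u l ->
       is_lim_seq (fun n => k * u n) (k * l)).
    { intros k u l Hu. now apply (is_lim_seq_scal_l u k (Finite l)). }
    repeat apply is_lim_seq_plus'; try apply is_lim_seq_const; try apply Hm; try assumption.
    apply is_lim_seq_plus'; [assumption|now apply is_lim_seq_exp_pow_0].
Qed.

Theorem mainTheorem5 (b : R) (hb : 1 < b) :
  ex_series (fun j : nat => exp (- (1 / b ^ j)) - 1 + exp (- b ^ j)) /\
  is_series
    (fun j : nat =>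
       Re (CGamma (RtoC 2 * Ci * RtoC PI * RtoC (INR (S j)) / RtoC (ln b))%C))
    (ln b / 2 * Series (fun j : nat => exp (- (1 / b ^ j)) - 1 + exp (- b ^ j))
     + (1 / 4 - 1 / (2 * exp 1)) * ln b
     + Euler_Mascheroni / 2).
Proof.
  split; [now apply ex_series_double_exp_term|].
  change (fun j : nat => exp (- (1 / b ^ j)) - 1 + exp (- b ^ j))
    with (double_exp_term b).
  set (V := _ + Euler_Mascheroni / 2).
  pose proof (ln_pos b hb) as HL.
  assert (Harg : forall j,
    (RtoC 2 * Ci * RtoC PI * RtoC (INR (S j)) / RtoC (ln b))%C = (0, frequency b j)).
  { intros j. unfold frequency, Cdiv, Cinv, Cmult, Ci, RtoC. cbn -[INR].
    f_equal; field; lra. }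
  apply is_series_ext with (fun j => Re (CGamma (0, frequency b j))).
  { intros j. now rewrite Harg. }
  set (g := fun j => Re (CGamma (0, frequency b j))).
  (* M tends to infinity while the number of terms is fixed *)
  assert (Hg : forall N, Rabs (sum_n g N - V) <= 2 * Fourier_error b N).
  { intros N.
    assert (H1 : is_lim_seq (fun M => Rabs (sum_n (fun j =>
        RInt (fun t => sin (frequency b j * ln t) / frequency b j * exp (- t))
          (/ b ^ M) (b ^ M)) N
        - (half_trapezoid_sum b M - RInt (fun t => exp (- t) / t) (/ b ^ M) (b ^ M) / 2)))
      (Rabs (sum_n g N - V))).
    { apply (is_lim_seq_abs _ (Finite _)). apply is_lim_seq_minus'.
      - apply (is_lim_seq_sum_n (fun j M =>
          RInt (fun t => sin (frequency b j * ln t) / frequency b j * exp (- t))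
            (/ b ^ M) (b ^ M))).
        intros j. apply (Re_CGamma_imaginary _ (fun M => / b ^ M) (fun M => b ^ M)).
        + pose proof (frequency_pos b j hb). lra.
        + now apply is_lim_seq_inv_pow_0.
        + intros M. apply Rinv_0_lt_compat, pow_lt. lra.
        + now apply is_lim_seq_pow_infty.
      - now apply is_lim_seq_half_trapezoid_sum. }
    refine (is_lim_seq_le _ _ _ _ _ H1 (is_lim_seq_const (2 * Fourier_error b N))).
    intros M.
    assert (HM : 1 <= b ^ M) by (apply pow_R1_Rle; lra).
    rewrite <- RInt_log_sawtooth; [|exact hb|].
    - eapply Rle_trans; [right|apply (Euler_Maclaurin b N M hb)]. f_equal. ring.
    - split; [apply Rinv_0_lt_compat; lra|].
      apply Rle_trans with (/ 1); [apply Rinv_le_contravar|]; lra. }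
  assert (He : is_lim_seq (fun N => 2 * Fourier_error b N) 0).
  { apply is_lim_seq_ext with (fun N => 4 * (ln b / (2 * PI)) ^ 2 * / INR (S N)).
    - intros N. unfold Fourier_error. unfold Rdiv at 3. ring.
    - replace (Finite 0) with (Rbar_mult (4 * (ln b / (2 * PI)) ^ 2) 0)
        by (simpl; f_equal; ring).
      apply is_lim_seq_scal_l.
      apply (is_lim_seq_incr_1 (fun n => / INR n)).
      apply (is_lim_seq_inv _ p_infty); [apply is_lim_seq_INR|discriminate]. }
  change (is_lim_seq (sum_n g) V).
  apply is_lim_seq_le_le with (fun N => V - 2 * Fourier_error b N)
    (fun N => V + 2 * Fourier_error b N).
  - intros N. specialize (Hg N). apply Rabs_le_between in Hg. lra.
  - replace V with (V - 0) at 1 by ring.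
    apply is_lim_seq_minus'; [apply is_lim_seq_const|exact He].
  - replace V with (V + 0) at 1 by ring.
    apply is_lim_seq_plus'; [apply is_lim_seq_const|exact He].
Qed.
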